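(* Let $n\ge 3$ and let $Dic_{4n}=\langle a,x: a^{2n}=e,\ x^2=a^n,\ ax=xa^{-1}\rangle$ be the dicyclic group of order $4n$. Then the characteristic polynomial of the distance matrix of the enhanced power graph of $Dic_{4n}$ is \[ \phi_D(\mathcal{G}_E(Dic_{4n}),x) = (x+1)^{3n-2} (x+3)^{n-1}\big(x^3-(6n-5)x^2-(8n^2+4n-7)x-(6n-3)\big). \]
   Context: For a group $G$, the enhanced power graph $\mathcal{G}_E(G)$ is the simple graph with vertex set $G$ in which distinct $a,b$ are adjacent if and only if $a,b\in\langle c\rangle$ for some $c\in G$. The distance matrix of a connected graph has $(u,v)$-entry equal to the graph distance $d(u,v)$ (and $0$ on the diagonal), and $\phi_D(\Gamma,x)=\det(xI-D(\Gamma))$. *)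

(* Defs.v *)
From HB Require Import structures.
From mathcomp Require Export all_boot all_order all_algebra all_fingroup.
From mathcomp Require Export all_solvable.

Set Implicit Arguments.
Unset Strict Implicit.
Unset Printing Implicit Defensive.

Import GRing.Theory.

Definition enhanced_power_graph (gT : finGroupType) : rel gT :=
  [rel a b : gT | (a != b) && [exists c : gT, (a \in <[c]>%g) && (b \in <[c]>%g)]].

Definition has_walk (T : finType) (e : rel T) (k : nat) (u v : T) : bool :=
  [exists p : k.-tuple T, path e u p && (last u p == v)].

(* Shortest walks have fewer than #|T| edges, so the search bound is harmless
   (see gdistP and gdist_min); #|T| is the value at disconnected pairs. *)
Definition gdist (T : finType) (e : rel T) (u v : T) : nat :=
  find (fun k => has_walk e k u v) (iota 0 #|T|).

Definition distance_matrix (T : finType) (e : rel T) : 'M[int]_#|T| :=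
  (\matrix_(i, j) (gdist e (enum_val i) (enum_val j))%:Z)%R.

Lemma has_walkP (T : finType) (e : rel T) k u v :
  reflect (exists p, [/\ path e u p, last u p = v & size p = k])
          (has_walk e k u v).
Proof.
apply: (iffP existsP) => [[p /andP[up /eqP lp]]|[p [up lp sp]]].
  by exists p; rewrite size_tuple.
by exists (tcast sp (in_tuple p)); rewrite val_tcast /= up lp eqxx.
Qed.

Lemma has_short_walk (T : finType) (e : rel T) u v :
  connect e u v -> has (fun k => has_walk e k u v) (iota 0 #|T|).
Proof.
case/connectP=> p up ->; case/shortenP: up => q uq Uq _.
apply/hasP; exists (size q); last by apply/has_walkP; exists q.
by rewrite mem_iota /= add0n -[(size q).+1]/(size (u :: q)) -(card_uniqP Uq) max_card.
Qed.

Lemma gdistP (T : finType) (e : rel T) u v : connect e u v ->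
  exists p, [/\ path e u p, last u p = v & size p = gdist e u v].
Proof.
move=> uv; apply/has_walkP; have hw := has_short_walk uv.
have := nth_find 0 hw; rewrite nth_iota ?add0n //.
by rewrite -[X in _ < X](size_iota 0) -has_find.
Qed.

Lemma gdist_min (T : finType) (e : rel T) u p :
  path e u p -> gdist e u (last u p) <= size p.
Proof.
move=> up; set v := last u p.
have hw : has (fun k => has_walk e k u v) (iota 0 #|T|).
  by apply: has_short_walk; apply/connectP; exists p.
have gT : gdist e u v < #|T|.
  by rewrite -[X in _ < X](size_iota 0) -has_find.
case: (leqP (gdist e u v) (size p)) => // lt_p.
have := before_find 0 lt_p; rewrite nth_iota ?add0n; last exact: ltn_trans gT.
by move=> /negbT/negP[]; apply/has_walkP; exists p.
Qed.

Lemma enhanced_power_graph_connected (gT : finGroupType) (u v : gT) :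
  connect (@enhanced_power_graph gT) u v.
Proof.
have adj1 w : connect (@enhanced_power_graph gT) w 1%g
           && connect (@enhanced_power_graph gT) 1%g w.
  have [-> | nt_w] := eqVneq w 1%g; first by rewrite connect0.
  by apply/andP; split; apply: connect1; apply/andP; split;
    rewrite // 1?eq_sym //; apply/existsP; exists w; rewrite cycle_id group1.
by case/andP: (adj1 u) => u1 _; case/andP: (adj1 v) => _; apply: connect_trans.
Qed.

(* Main.v *)
Require Import Defs.
From mathcomp Require Import ring zify.

(** In Dic_{4n} every element outside <a> squares to a^n, so the closed
    adjacency of the enhanced power graph only depends on the classes
    {1, a^n}, <a> \ {1, a^n} and {a^k x, a^(k+n) x} (k < n), and all distances
    are at most 2. Hence D + I is constant on products of classes, and
    Sylvester's identity det(y - AB) y^k = y^m det(y - BA) reduces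
    det(x - D) to a determinant of size n + 2 up to a power of y = x + 1.
    After a further shift by 2 the n classes outside <a> become
    indistinguishable too, and a second use of the identity, now at
    y + 2 = x + 3, leaves a 3 x 3 determinant. *)

Set Implicit Arguments.
Unset Strict Implicit.
Unset Printing Implicit Defensive.

Import GRing.Theory.

(** * Dicyclic groups: order, normal form, cyclic subgroups *)

Section DicyclicGroup.

Local Open Scope group_scope.

(* The presentation does not collapse: it is realised by the right regular
   permutations of the formal products a^i x^j, encoded as pairs (i, j). *)
Lemma dicyclic_card_geq (n : nat) (gT : finGroupType) : 0 < n ->
  [set: gT] \isog
     Grp (a : x : a ^+ (2 * n), x ^+ 2 = a ^+ n, a * x = x * a^-1) ->
  4 * n <= #|gT|.
Proof.
move=> n_gt0 isoG.
pose V := ('Z_(2 * n) * bool)%type.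
have n2_gt1 : 1 < 2 * n by lia.
have nn0 : (n%:R + n%:R = 0 :> 'Z_(2 * n))%R.
  by rewrite -natrD addnn -mul2n pchar_Zp.
(* Right multiplication by [a] shifts the exponent by [sg j] since [x * a = a^-1 * x]; right
   multiplication by [x] turns [x ^+ 2] into [a ^+ n]. *)
pose sg (j : bool) : 'Z_(2 * n) := (if j then -1 else 1)%R.
pose fA (v : V) : V := (v.1 + sg v.2, v.2)%R.
pose fX (v : V) : V := (if v.2 then (v.1 + n%:R, false) else (v.1, true))%R.
have injA : injective fA.
  move=> [i j] [i' j'] e; have ej : j = j' := congr1 snd e.
  by have := congr1 fst e; rewrite /= ej => /addIr ->.
have injX : injective fX.
  move=> [i []] [i' []] // e; have := congr1 fst e => /=.
    by move/addIr->.
  by move->.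
pose A := perm injA; pose X := perm injX.
have expA m v : (A ^+ m) v = (v.1 + sg v.2 *+ m, v.2)%R.
  elim: m v => [|m IH] v; first by rewrite expg0 perm1 mulr0n addr0; case: v.
  by rewrite expgSr permM IH permE /fA /= mulrSr addrA.
have rel1 : A ^+ (2 * n) = 1.
  apply/permP=> -[i j]; rewrite expA perm1 /= -mulr_natl.
  by rewrite pchar_Zp // mul0r addr0.
have sgn j : (sg j *+ n = n%:R)%R.
  case: j; rewrite /sg // mulNrn; apply/eqP; rewrite eq_sym -subr_eq0 opprK.
  by apply/eqP.
have rel2 : X ^+ 2 = A ^+ n.
  by apply/permP=> -[i j]; rewrite expA expgS expg1 permM !permE /fX sgn; case: j.
have rel3 : A * X = X * A^-1.
  apply: (mulIg A); rewrite -!mulgA mulVg mulg1.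
  apply/permP=> -[i j]; rewrite !permM !permE /fX /fA; case: j => /=.
    by rewrite addrAC addrNK.
  by rewrite addrK.
pose H := (<[A]> <*> <[X]>)%G.
have : H \homg [set: gT].
  rewrite isoG; apply/existsP; exists (A, X) => /=.
  by rewrite rel1 rel2 rel3 eqxx.
move/card_homg/(dvdn_leq (cardG_gt0 _)); rewrite cardsT; apply: leq_trans.
have -> : (4 * n)%N = #|{: V}|.
  by rewrite card_prod card_bool card_ord Zp_cast //; lia.
rewrite -[X in X <= _]cardsT.
(* The orbit of [(0, false)] under [H] is all of [V], which bounds [#|H|] from below. *)
apply: (@leq_trans #|[set (s : {perm V}) (0%R, false) | s in H]|).
  2: exact: leq_imset_card.
apply/subset_leq_card/subsetP => -[i j] _; apply/imsetP.
exists (A ^+ i * X ^+ j).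
  by rewrite groupM // groupX // ?mem_gen // inE cycle_id ?orbT.
rewrite permM expA /= add0r natr_Zp; case: j => /=; first by rewrite expg1 permE.
by rewrite expg0 perm1.
Qed.

(** Splitting the exponent of [a] as [k + b * n] makes multiplication by the central element
    [a ^+ n] flip [b], so the class depends on [k] and [j] only. *)
Definition dic_elt (gT : finGroupType) (n : nat) (a x : gT)
  (u : bool * bool * 'I_n) : gT := a ^+ (u.2 + u.1.1 * n) * x ^+ u.1.2.

(* Class 0 is {1, a^n}, class 1 the rest of <a>, and class k + 2 is
   {a^k x, a^(k+n) x}. *)
Definition dic_class (n : nat) (u : bool * bool * 'I_n) : nat :=
  if u.1.2 then u.2.+2 else ((u.2 : nat) != 0).

Section Dicyclic.

Variables (gT : finGroupType) (n : nat) (a x : gT).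
Hypotheses (n_gt0 : 0 < n) (a2n : a ^+ (2 * n) = 1) (x2 : x ^+ 2 = a ^+ n)
  (ax : a * x = x * a^-1).

Lemma dic_elt_expg (i : nat) (j : bool) :
  a ^+ i * x ^+ j =
  dic_elt a x (odd (i %/ n), j, Ordinal (ltn_pmod i n_gt0)).
Proof.
rewrite /dic_elt /=; congr (_ * _).
rewrite {1}(divn_eq i n) addnC -{1}(odd_double_half (i %/ n)) mulnDl addnA.
by rewrite -mul2n mulnAC expgD expgM a2n expg1n mulg1.
Qed.

Lemma expg_invert i : a ^+ i * x = x * a ^- i.
Proof.
elim: i => [|i IH]; first by rewrite !expg0 invg1 mulg1 mul1g.
by rewrite {1}expgSr -mulgA ax mulgA IH -mulgA -invMg -expgS.
Qed.

Lemma dic_sqr i : (a ^+ i * x) ^+ 2 = a ^+ n.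
Proof.
rewrite expgS expg1 {1}expg_invert mulgA -(mulgA x) mulVg mulg1.
by rewrite -x2 expgS expg1.
Qed.

(** Each pair of factors contributes [a ^+ n], so every power of [a ^+ i * x] lies in class 0 or in
    the class of [a ^+ i * x] itself. *)
Lemma dic_expg i s :
  (a ^+ i * x) ^+ s = a ^+ (s./2 * n + odd s * i) * x ^+ odd s.
Proof.
rewrite -{1}(odd_double_half s) addnC expgD -mul2n expgM dic_sqr -expgM.
rewrite expgD -mulgA (mulnC n); congr (_ * _).
by case: (odd s); rewrite ?mul0n ?mul1n ?expg0 ?expg1 ?mulg1.
Qed.

Lemma dic_elt_surj : <[a]> <*> <[x]> = [set: gT] ->
  forall g, exists u : bool * bool * 'I_n, dic_elt a x u = g.
Proof.
move=> defG g; have: g \in <[a]> <*> <[x]> by rewrite defG inE.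
have nax : <[x]> \subset 'N(<[a]>).
  rewrite cycle_subG; apply/normP; rewrite -cycleJ.
  by rewrite /conjg ax mulKg cycleV.
rewrite norm_joinEr // => /mulsgP[_ _ /cycleP[i ->] /cycleP[j ->] ->].
(* Even powers of [x] are absorbed into [<[a]>]; [dic_elt_expg] then supplies the witness. *)
eexists; rewrite -[RHS](_ : a ^+ (i + j./2 * n) * x ^+ odd j = _).
  by rewrite dic_elt_expg.
rewrite expgD -mulgA; congr (_ * _).
by rewrite mulnC expgM -x2 -expgM -expgD mul2n addnC odd_double_half.
Qed.

Variable h : gT -> bool * bool * 'I_n.
Hypothesis eltK : cancel (dic_elt a x) h.
Hypothesis hK : cancel h (dic_elt a x).

Lemma dic_class_expg (i : nat) (j : bool) :
  dic_class (h (a ^+ i * x ^+ j)) = if j then (i %% n).+2 else (i %% n != 0).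
Proof. by rewrite dic_elt_expg eltK. Qed.

Lemma dic_cocyclicE (g g' : gT) :
  let p := dic_class (h g) in let q := dic_class (h g') in
  [exists c : gT, (g \in <[c]>) && (g' \in <[c]>)] =
  [|| p == 0, q == 0 | p == q].
Proof.
apply/existsP/idP => [[c /andP[]] | ].
  have := hK c; case: (h c) => -[b j] k; rewrite /dic_elt /=.
  set i := (k + b * n)%N; case: j => <-; rewrite ?expg0 ?expg1 ?mulg1.
    case/cycleP=> s ->; case/cycleP=> t ->; rewrite !dic_expg !dic_class_expg.
    by rewrite !modnMDl; case: (odd s); case: (odd t); rewrite ?mul0n ?mod0n ?eqxx ?orbT.
  case/cycleP=> s ->; case/cycleP=> t ->.
  rewrite -!expgM -[a ^+ (i * s)]mulg1 -[a ^+ (i * t)]mulg1.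
  rewrite (dic_class_expg _ false) (dic_class_expg _ false).
  by do 2!case: (_ %% n == 0)%N.
(* Class 0 consists of powers of [a ^+ n], which is a power of [a] and the square of every element
   outside [<[a]>]. *)
have cen (u u' : gT) : dic_class (h u) = 0 ->
    exists c : gT, (u \in <[c]>) && (u' \in <[c]>).
  move: (hK u) (hK u'); case: (h u) (h u') => -[b j] k [[b' j'] k'].
  rewrite /dic_class /dic_elt /= => <- <-; case: j => //; case: eqP => // -> _.
  rewrite expg0 mulg1 add0n; case: j'.
    exists (a ^+ (k' + b' * n) * x); rewrite expg1 cycle_id andbT.
    by rewrite mulnC expgM -(dic_sqr (k' + b' * n)) -expgM mem_cycle.
  by exists a; rewrite expg0 mulg1 !mem_cycle.
case/or3P=> [/eqP/cen | /eqP | ]; first by apply.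
  by move/(cen _ g) => [c gc]; exists c; rewrite andbC.
move: (hK g) (hK g'); case: (h g) (h g') => -[b j] k [[b' j'] k'].
rewrite /dic_class /dic_elt /=; case: j; case: j'; last 1 first.
- by move=> <- <- _; exists a; rewrite !expg0 !mulg1 !mem_cycle.
- move=> <- <-; rewrite !eqSS !expg1 => /eqP ->.
  exists (a ^+ (k' + b * n) * x); rewrite cycle_id /=.
  have [<- | nb] := eqVneq b b'; first exact: cycle_id.
  (* Cubing an element outside [<[a]>] multiplies it by [a ^+ n], which gives the other member of
     its class. *)
  have -> : a ^+ (k' + b' * n) * x = (a ^+ (k' + b * n) * x) ^+ 3.
    rewrite dic_expg /= expg1; congr (_ * _); case: b b' nb => [] [] //= _.
      by rewrite !mul1n mul0n addn0 addnCA addnn -mul2n expgD a2n mulg1.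
    by rewrite !mul1n mul0n addn0 addnC.
  exact: mem_cycle.
- by move=> _ _; case: (_ == 0)%N.
- by move=> _ _; case: (_ == 0)%N.
Qed.

End Dicyclic.

Lemma dicyclic_coordinates (n : nat) (gT : finGroupType) : 0 < n ->
  [set: gT] \isog
     Grp (a : x : a ^+ (2 * n), x ^+ 2 = a ^+ n, a * x = x * a^-1) ->
  exists h : gT -> bool * bool * 'I_n, bijective h /\
    forall g g', let p := dic_class (h g) in let q := dic_class (h g') in
    [exists c : gT, (g \in <[c]>) && (g' \in <[c]>)] =
    [|| p == 0, q == 0 | p == q].
Proof.
move=> n_gt0 isoG; have := isoGrp_hom isoG.
case/existsP=> -[a x] /= /eqP[defG a2n x2 ax].
have surj := dic_elt_surj n_gt0 a2n x2 ax defG.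
have [h hK] := fin_all_exists surj.
have bij_h : bijective h.
  (* As a section of a surjection [h] is injective; the lower bound on the group order makes it
     bijective. *)
  apply: inj_card_bij (can_inj hK) _; rewrite !card_prod card_bool card_ord.
  exact: dicyclic_card_geq isoG.
exists h; split=> // g g'.
by apply: (dic_cocyclicE n_gt0 a2n x2 ax) => //; apply/(bij_can_sym bij_h).
Qed.

End DicyclicGroup.

(** * Determinants of class-constant matrices *)

Local Open Scope ring_scope.

(** Both sides are [y ^+ k] times the determinant of the block matrix with rows [y, A] and [B, 1];
    no inverse of [y] is taken. *)
Lemma det_sub_mulmxC (R : comNzRingType) m k (y : R)
    (A : 'M[R]_(m, k)) (B : 'M[R]_(k, m)) :
  \det (y%:M - A *m B) * y ^+ k = y ^+ m * \det (y%:M - B *m A).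
Proof.
have eqM : block_mx (y%:M : 'M_m) A B 1%:M *m block_mx 1%:M 0 (- B) y%:M
         = block_mx (y%:M - A *m B) (y *: A) 0 y%:M.
  rewrite mulmx_block !mulmx1 !mulmx0 !mul1mx !add0r mulmxN subrr.
  by rewrite mul_mx_scalar.
have eqN : block_mx (y%:M : 'M_m) A B 1%:M *m block_mx 1%:M (- A) 0 y%:M
         = block_mx y%:M 0 B (y%:M - B *m A).
  rewrite mulmx_block !mulmx1 !mulmx0 !mul1mx !addr0 mulmxN.
  by rewrite mul_mx_scalar mul_scalar_mx addNr addrC mulmxN.
move/(congr1 determinant): eqM; move/(congr1 determinant): eqN.
rewrite !det_mulmx det_ublock det_ublock !det_lblock !det1 !det_scalar !mul1r.
by move=> -> <-.
Qed.

(** The matrix is [A *m B] with [A] the class indicator; [B *m A] is the quotient matrix, whose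
    column [q] is weighted by the size of class [q]. *)
Lemma det_lumped (R : comNzRingType) m k (c : 'I_m -> 'I_k)
    (F : 'I_k -> 'I_k -> R) (y : R) :
  \det (y%:M - \matrix_(i, j) F (c i) (c j)) * y ^+ k =
  y ^+ m * \det (y%:M - \matrix_(p, q) (F p q *+ \sum_i (c i == q))).
Proof.
pose A := \matrix_(i, p) ((c i == p)%:R : R).
pose B := \matrix_(p, j) F p (c j).
have -> : \matrix_(i, j) F (c i) (c j) = A *m B.
  apply/matrixP=> i j; rewrite !mxE (bigD1 (c i)) //= !mxE eqxx mul1r.
  by rewrite big1 ?addr0 // => p np; rewrite !mxE eq_sym (negPf np) mul0r.
rewrite det_sub_mulmxC; congr (_ * \det (_ - _)).
apply/matrixP=> p q; rewrite !mxE -sumrMnr; apply: eq_bigr => i _.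
by rewrite !mxE; case: eqP => [-> | _]; rewrite ?mulr1 ?mulr0.
Qed.

(** * Distances in an enhanced power graph *)

(** The term [u == v] turns D into D + I, so the diagonal follows the rule for adjacent pairs; other
    pairs are joined through the identity. *)
Lemma gdist_enhanced_power_graph (gT : finGroupType) (u v : gT) :
  (gdist (@enhanced_power_graph gT) u v + (u == v) =
   if [exists c : gT, (u \in <[c]>%g) && (v \in <[c]>%g)] then 1 else 2)%N.
Proof.
set e := @enhanced_power_graph gT.
have eE a b : e a b = (a != b) &&
  [exists c : gT, (a \in <[c]>%g) && (b \in <[c]>%g)] by [].
have [p [up lp sp]] := gdistP (enhanced_power_graph_connected u v).
have [euv | nuv] := eqVneq u v.
  have /= := @gdist_min _ e u [::] isT; rewrite -euv leqn0 => /eqP ->.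
  by case: existsP => // -[]; exists u; rewrite cycle_id.
rewrite addn0; rewrite -/e in up lp sp *.
case: ifP => ex.
  have /= := @gdist_min _ e u [:: v]; rewrite eE nuv ex => /(_ isT).
  by rewrite -sp; case: p lp {up sp} => [|? []] // /eqP; rewrite (negPf nuv).
have adj1 w : [exists c : gT, (w \in <[c]>%g) && (1%g \in <[c]>%g)].
  by apply/existsP; exists w; rewrite cycle_id group1.
have adj1' w : [exists c : gT, (1%g \in <[c]>%g) && (w \in <[c]>%g)].
  by apply/existsP; exists w; rewrite cycle_id group1.
have nu1 : u != 1%g by apply: contraFneq ex => ->.
have nv1 : 1%g != v by apply: contraFneq ex => <-.
have /= := @gdist_min _ e u [:: 1%g; v].
rewrite !eE nu1 nv1 adj1 adj1' => /(_ isT); rewrite -sp.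
case: p up lp {sp} => [|w [|w' []]] //=; first by move=> _ /eqP; rewrite (negPf nuv).
by rewrite eE => /andP[/andP[_ ew] _] wv; rewrite wv ex in ew.
Qed.

(** * Class sizes and the reduction to a 3 x 3 determinant *)

Lemma dic_class_lt (n : nat) (u : bool * bool * 'I_n) : (dic_class u < n.+2)%N.
Proof.
rewrite /dic_class; case: ifP => _; last by case: (_ == _).
by rewrite !ltnS.
Qed.

Lemma dic_class_count (n : nat) (q : 'I_n.+2) : (0 < n)%N ->
  (\sum_(u : bool * bool * 'I_n) (dic_class u == q) =
   if q == 1 :> nat then 2 * n - 2 else 2)%N.
Proof.
case: n q => // n q _.
rewrite -(pair_bigA _ (fun b k => dic_class (b, k) == q : nat)) /=.
rewrite -(pair_bigA _ (fun b j => \sum_k (dic_class (b, j, k) == q))%N) /=.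
rewrite !big_bool /= /dic_class /=.
have -> : (\sum_(k < n.+1) ((k != 0 :> nat : nat) == q) =
   if q == 0 :> nat then 1 else if q == 1 :> nat then n else 0)%N.
  rewrite big_ord_recl /= (eq_bigr (fun=> q == 1 :> nat : nat)) => [|k _].
    rewrite sum_nat_const card_ord.
    by case: (q : nat) => [|[|m]] /=; rewrite ?muln0 ?muln1.
  by rewrite eq_sym.
have -> : (\sum_(k < n.+1) (k.+2 == q) = (1 < q))%N.
  case: q => [[|[|q]] /= lt_q]; try by rewrite big1.
  rewrite (bigD1 (Ordinal (lt_q : q < n.+1)%N)) //= eqxx big1 // => k.
  by rewrite -val_eqE /= => /negPf nk; rewrite !eqSS nk.
by case: (q : nat) => [|[|m]] /=; lia.
Qed.

(** The map [minn p 2] merges all classes outside [<a>] into the single index 2. *)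
Lemma min2_lt3 (p : nat) : (minn p 2 < 3)%N.
Proof. by rewrite ltnS geq_minr. Qed.

Lemma sum_min2_eq (n : nat) (q : 'I_3) :
  (\sum_(p < n.+2) (Ordinal (min2_lt3 p) == q) =
   if q == 2 :> nat then n else 1)%N.
Proof.
rewrite 2!big_ord_recl /= (eq_bigr (fun=> q == 2 :> nat : nat)) => [|k _].
  by rewrite sum_nat_const card_ord -!val_eqE /=; case: q => [[|[|[|]]]] //=; lia.
by rewrite -val_eqE /= eq_sym; congr (_ == _ : nat); rewrite /= /bump /=; lia.
Qed.

(** The entry of D + I between elements of classes [p] and [q]. *)
Definition class_dist (p q : nat) : nat :=
  if [|| p == 0, q == 0 | p == q]%N then 1 else 2.

Lemma det_class (R : comNzRingType) (n : nat) (y : R) : (0 < n)%N ->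
  \det (y%:M - \matrix_(p < n.+2, q < n.+2)
     ((class_dist p q)%:R *+ (if q == 1 :> nat then 2 * n - 2 else 2)%N))
   * (y + 2) ^+ 3
  = (y + 2) ^+ n.+2 * ((y - 1) ^+ 3 - (6 * n%:R - 5) * (y - 1) ^+ 2
    - (8 * n%:R ^+ 2 + 4 * n%:R - 7) * (y - 1) - (6 * n%:R - 3)).
Proof.
move=> n_gt0.
(* For indices at least 2 the weighted entries are 4 off the diagonal and 2 on it, so adding 2 to
   the diagonal makes them constant. Indices 0 and 1 are not merged and keep the correction
   explicitly. *)
pose F (p q : 'I_3) : R := if (p == 2 :> nat) && (q == 2 :> nat) then 4 else
  ((class_dist p q)%:R *+ (if q == 1 :> nat then 2 * n - 2 else 2)%N)
   + 2 *+ (p == q).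
rewrite (_ : _ - _ = (y + 2)%:M - \matrix_(p < n.+2, q < n.+2)
   F (Ordinal (min2_lt3 p)) (Ordinal (min2_lt3 q))); last first.
  apply/matrixP=> p q; rewrite !mxE /F -!val_eqE /=.
  case: p q => [[|[|p]] ?] [[|[|q]] ?] //=; rewrite /class_dist ?minnSS ?minn0 //=.
  all: rewrite ?mulr0n ?mulr1n ?subr0 ?sub0r ?addr0 //; try ring.
  rewrite !eqSS; case: eqP => _; rewrite ?mulr1n ?mulr0n; ring.
rewrite det_lumped; congr (_ * _).
rewrite (expand_det_row _ 0) !big_ord_recl big_ord0 /cofactor.
rewrite !(expand_det_row _ 0) !big_ord_recl !big_ord0 /cofactor !det_mx11.
rewrite !mxE !sum_min2_eq /F /class_dist /= /bump /=.
(* Truncated subtraction is removed before [ring] by making [n] a successor. *)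
have -> : (2 * n - 2)%N = (2 * n.-1)%N by lia.
case: n n_gt0 {F} => // n _ /=.
rewrite ?addr0 ?mulr0n ?mulr1n.
ring.
Qed.

Theorem theorem3p6 (n : nat) (n_ge3 : (3 <= n)%N) (gT : finGroupType)
  (Dic4n : ([set: gT] \isog
     Grp (a : x : a ^+ (2 * n)%N, x ^+ 2 = a ^+ n, a * x = x * a^-1))%g) :
  char_poly (distance_matrix (@enhanced_power_graph gT)) =
    ('X + 1) ^+ (3 * n - 2) * ('X + 3%:P) ^+ (n - 1) *
    ('X^3 - (6 * n%:Z - 5)%:P * 'X^2
          - (8 * n%:Z ^+ 2 + 4 * n%:Z - 7)%:P * 'X
          - (6 * n%:Z - 3)%:P) :> {poly int}.
Proof.
have n_gt0 : (0 < n)%N by lia.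
have [h [bij_h cocyc]] := dicyclic_coordinates n_gt0 Dic4n.
have cardG : #|gT| = (4 * n)%N.
  by rewrite (bij_eq_card bij_h) !card_prod card_bool card_ord.
pose c (i : 'I_#|gT|) := Ordinal (dic_class_lt (h (enum_val i))).
pose E : 'M[{poly int}]_#|gT| :=
  \matrix_(i, j) (class_dist (c i) (c j))%:R.
have -> : char_poly (distance_matrix (@enhanced_power_graph gT)) =
    \det (('X + 1)%:M - E).
  congr (\det _); apply/matrixP=> i j; rewrite !mxE /class_dist /= -cocyc.
  rewrite -gdist_enhanced_power_graph (inj_eq enum_val_inj).
  by rewrite natrD mulrnDl -natz polyC_natr; ring.
have lump1 := det_lumped c (fun p q => (class_dist p q)%:R) ('X + 1 : {poly int}).
have count q : (\sum_i (c i == q) = if q == 1 :> nat then 2 * n - 2 else 2)%N.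
  rewrite -dic_class_count // (reindex h) /=; last exact: onW_bij.
  transitivity (\sum_(g in gT) (dic_class (h g) == q))%N.
    by rewrite [RHS]big_enum_val.
  by apply: eq_bigl.
have lump2 := @det_class {poly int} n ('X + 1) n_gt0.
have X1 : 'X + 1 != 0 :> {poly int}.
  by rewrite -[1]/(1%:P) monic_neq0 ?monicXaddC.
have X3 : 'X + 3%:P != 0 :> {poly int} by rewrite monic_neq0 ?monicXaddC.
move: lump1 lump2; set M := \matrix_(p, q) (_ *+ _).
set N := \matrix_(p, q) (_ *+ _); have -> : M = N.
  by apply/matrixP=> p q; rewrite !mxE count.
have e3 : 'X + 1 + 2 = 'X + 3%:P :> {poly int}.
  by rewrite -[3]/(3%:R) polyC_natr; ring.
rewrite e3 addrK => lump1 lump2.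
(* The two reductions hold up to the nonzero factors [('X + 1) ^+ n.+2] and [('X + 3%:P) ^+ 3],
   cancelled here; the exponents [3 * n - 2] and [n - 1] are what remains. *)
apply: (mulIf (expf_neq0 n.+2 X1)); rewrite lump1.
apply: (mulIf (expf_neq0 3 X3)); rewrite -[LHS]mulrA lump2 cardG.
have -> : (4 * n)%N = (3 * n - 2 + n.+2)%N by lia.
have -> : n.+2 = (n - 1 + 3)%N by lia.
have nP : (n%:Z)%:P = n%:R :> {poly int} by rewrite -natz polyC_natr.
rewrite !exprD !(rmorphB, rmorphD, rmorphM, rmorphXn) /= nP.
by ring.
Qed.
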